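(* Let $n$ be a power of $2$, let $k\ge 2$ be an integer, and let $\Phi$ be the random $k\times n$ matrix whose rows are $k$ rows chosen independently and uniformly at random from the unnormalized $n\times n$ Hadamard matrix $\Psi$, $\Psi_{\omega,t}=(-1)^{\langle \omega,t\rangle}$. Let $\alpha>0$ be any real number and define $$E_\alpha=\mathbb{E}_{\Phi}\left[\sup_{y\in B_2\cap \alpha B_\infty}\left\|D_y^2-\frac1k D_y\Phi^t\Phi D_y\right\|\right].$$ Then there is a global constant $C_1>0$ (independent of $n,k,\alpha$) such that $$E_\alpha\le \frac{C_1\log^{3/2}(n)\log^{1/2}(k)}{\sqrt k}\,(E_\alpha+\alpha^2)^{1/2}.$$ In particular, if $\frac{(\log^{3/2}n)(\log^{1/2}k)}{\sqrt k}=O(\alpha)$, then $$E_\alpha=O\left(\frac{\alpha(\log^{3/2}n)(\log^{1/2}k)}{\sqrt k}\right).$$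
   Context: In the Hadamard matrix, $\omega,t\in\{0,\dots,n-1\}$ are identified with vectors in $\{0,1\}^{\log_2 n}$ and $\langle\omega,t\rangle$ is the dot product over the binary field. For $y\in\mathbb{R}^n$, $D_y$ is the $n\times n$ diagonal matrix with the coordinates of $y$ on the diagonal. $\|\cdot\|$ of a matrix denotes its spectral norm and $(\cdot)^t$ the transpose. For $p\ge1$ and $\alpha>0$, $B_p=\{y\in\mathbb{R}^n:\|y\|_p\le1\}$ and $\alpha B_p=\{y\in\mathbb{R}^n:\|y\|_p\le\alpha\}$. The expectation is over the random choice of $\Phi$. *)

(* Defs.v *)
From HB Require Import structures.
From mathcomp Require Import all_boot all_order all_algebra.
From mathcomp Require Import all_classical all_reals all_analysis.

Set Implicit Arguments.
Unset Strict Implicit.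
Unset Printing Implicit Defensive.

Import Order.TTheory GRing.Theory Num.Theory.
Import numFieldNormedType.Exports.

Local Open Scope classical_set_scope.
Local Open Scope ring_scope.

(* Coordinate j of the vector of {0,1}^m encoding a number w < 2 ^ m is its
   binary digit of weight 2 ^ j; the cast of w %/ 2 ^ j into 'F_2 reduces it
   modulo 2. *)
Definition bits (m w : nat) : 'rV['F_2]_m := \row_(j < m) (w %/ 2 ^ j)%:R.

Definition bdot (m w t : nat) : 'F_2 :=
  \sum_(j < m) bits m w ord0 j * bits m t ord0 j.

(* trunc_log 2 n is the exact base 2 logarithm when n is a power of 2. *)
Definition hadamard (R : pzRingType) (n : nat) : 'M[R]_n :=
  \matrix_(w, t) (-1) ^+ (bdot (trunc_log 2 n) w t : nat).

Definition l2norm (R : realType) (n : nat) (x : 'cV[R]_n) : R :=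
  Num.sqrt (\sum_(i < n) x i ord0 ^+ 2).

Definition B2 (R : realType) (n : nat) : set 'cV[R]_n :=
  [set y | l2norm y <= 1].

(* The library norm `|y| of a matrix is the maximum of the absolute values of
   its entries. *)
Definition scaled_Binf (R : realType) (n : nat) (alpha : R) : set 'cV[R]_n :=
  [set y | `|y| <= alpha].

Definition spectral_norm (R : realType) (m n : nat) (A : 'M[R]_(m, n)) : R :=
  sup [set l2norm (A *m x) | x in [set x : 'cV[R]_n | l2norm x <= 1]].

Definition Dmx (R : realType) (n : nat) (y : 'cV[R]_n) : 'M[R]_n :=
  diag_mx y^T.

Definition Phi (R : realType) (n k : nat) (r : {ffun 'I_k -> 'I_n}) :
    'M[R]_(k, n) :=
  rowsub r (hadamard R n).

(* Nonempty (y = 0) and bounded (B2 is), so sup is a genuine supremum. *)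
Definition sup_deviation (R : realType) (n k : nat) (alpha : R)
    (r : {ffun 'I_k -> 'I_n}) : R :=
  sup [set spectral_norm
             (Dmx y ^+ 2 - k%:R^-1 *: (Dmx y *m (Phi R r)^T *m Phi R r *m Dmx y))
      | y in @B2 R n `&` @scaled_Binf R n alpha].

(* The row indices r 0, ..., r (k - 1) are independent and uniform on 'I_n, so
   the tuple r has probability \prod_(i < k) n^-1. *)
Definition expected_sup (R : realType) (n k : nat) (alpha : R) : R :=
  \sum_(r : {ffun 'I_k -> 'I_n})
    (\prod_(i < k) (n%:R : R)^-1) * sup_deviation alpha r.

Definition rate (R : realType) (n k : nat) : R :=
  ln n%:R `^ (3 / 2) * Num.sqrt (ln k%:R) / Num.sqrt k%:R.

(* Main.v *)
(* The quadratic form of D_y^2 - k^-1 D_y Phi^T Phi D_y at z is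
   |x|_2^2 - k^-1 |Phi x|_2^2 for the coordinatewise product x = y z, which
   satisfies |x|_1 <= 1 and |x|_2 <= alpha; its mean over Phi vanishes by
   orthogonality of the Hadamard columns.  After symmetrization one has to
   bound sup_x |sum_i e_i <phi_i, x>^2| for random signs e.  The increments of
   this process are controlled by S max_i |<phi_i, x - x'>|, where S bounds
   |Phi x|_2, and the l1 ball is covered at scale u in this metric by
   (2 n + 1) ^ O(ln k / u^2) points (Maurey's empirical method, derandomised
   with an exponential potential).  Chaining over the scales 2^-j, j <= log_2 n,
   gives O(S ln^(3/2) n ln^(1/2) k); below scale 1/n the trivial estimate
   suffices once equal rows are grouped together.  Finally
   S^2 = k (sup_deviation + alpha^2) and Jensen's inequality for the square root
   close the self-bounding estimate.

   Suprema of a process under the random signs are never formed: "the expected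
   supremum is at most b" is stated as the existence of a pointwise majorant G
   of the process with avg G <= b. *)

Require Import Defs.
From HB Require Import structures.
From mathcomp Require Import all_boot all_order all_algebra.
From mathcomp Require Import all_classical all_reals all_analysis.
From mathcomp Require Import ring lra.

Set Implicit Arguments.
Unset Strict Implicit.
Unset Printing Implicit Defensive.

Import Order.TTheory GRing.Theory Num.Theory.
Import numFieldNormedType.Exports.

Local Open Scope ring_scope.

(** * Expectations under uniform laws on finite types *)

Section Averages.
Context {R : realType}.

Definition avg (T : finType) (F : T -> R) : R := #|T|%:R^-1 * \sum_t F t.

Lemma le_avg (T : finType) (F G : T -> R) :
  (forall t, F t <= G t) -> avg F <= avg G.
Proof. by move=> FG; apply: ler_wpM2l; rewrite ?invr_ge0// ler_sum. Qed.

Lemma eq_avg (T : finType) (F G : T -> R) : F =1 G -> avg F = avg G.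
Proof. by move=> FG; congr (_ * _); apply: eq_bigr => t _; exact: FG. Qed.

Lemma avgD (T : finType) (F G : T -> R) :
  avg (fun t => F t + G t) = avg F + avg G.
Proof. by rewrite /avg big_split mulrDr. Qed.

Lemma avgZ (T : finType) (c : R) (F : T -> R) :
  avg (fun t => c * F t) = c * avg F.
Proof. by rewrite /avg -mulr_sumr mulrCA. Qed.

Lemma avgZr (T : finType) (c : R) (F : T -> R) :
  avg (fun t => F t * c) = avg F * c.
Proof. by rewrite /avg -mulr_suml mulrA. Qed.

Lemma avg_sum (T I : finType) (P : pred I) (F : I -> T -> R) :
  avg (fun t => \sum_(i | P i) F i t) = \sum_(i | P i) avg (F i).
Proof. by rewrite /avg exchange_big mulr_sumr. Qed.

Lemma avg_exchange (S T : finType) (F : S -> T -> R) :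
  avg (fun s => avg (F s)) = avg (fun t => avg (fun s => F s t)).
Proof.
by rewrite /avg -!mulr_sumr exchange_big mulrCA.
Qed.

Lemma avg_cst (T : finType) (t0 : T) (c : R) : avg (fun _ : T => c) = c.
Proof.
rewrite /avg sumr_const -[c *+ _]mulr_natl mulrA mulVf ?mul1r// pnatr_eq0.
by rewrite -lt0n; apply/card_gt0P; exists t0.
Qed.

(** This is independence: under the uniform law on functions the coordinates are independent and
    uniform. *)
Lemma avg_prod (I J : finType) (F : I -> J -> R) :
  avg (fun f : {ffun I -> J} => \prod_i F i (f i)) = \prod_i avg (F i).
Proof.
rewrite /avg big_split /= -bigA_distr_bigA prodr_const card_ffun natrX exprVn.
by [].
Qed.

Lemma avg_coord (I J : finType) (i : I) (f : J -> R) : (0 < #|J|)%N ->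
  avg (fun r : {ffun I -> J} => f (r i)) = avg f.
Proof.
move=> /card_gt0P[j0 _].
pose F l j := if l == i then f j else 1.
transitivity (avg (fun r : {ffun I -> J} => \prod_l F l (r l))).
  apply: eq_avg => r; rewrite (bigD1 i)//= /F eqxx big1 ?mulr1// => l.
  by move/negbTE ->.
rewrite avg_prod (bigD1 i)//= big1 ?mulr1.
  by apply: eq_avg => j; rewrite /F eqxx.
by move=> l /negbTE li; rewrite -[RHS](avg_cst j0); apply: eq_avg => j; rewrite /F li.
Qed.

Lemma avg_bij (T : finType) (h : T -> T) (F : T -> R) : injective h ->
  avg (fun t => F (h t)) = avg F.
Proof. by move=> h_inj; rewrite /avg [in RHS](reindex_inj h_inj). Qed.

(** The selection step of the derandomisation. If every [f v] exceeded [M], the nonnegative terms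
    [p v * (f v - M)] would have a nonpositive sum, so [p] would vanish identically. *)
Lemma weighted_exists_le (V : finType) (p f : V -> R) (M : R) :
  (forall v, 0 <= p v) -> \sum_v p v = 1 -> \sum_v p v * f v <= M ->
  exists v, f v <= M.
Proof.
move=> p0 p1 fM; apply: contrapT => nf.
have fgt v : M < f v by rewrite ltNge; apply/negP => fv; apply: nf; exists v.
have: \sum_v p v * (f v - M) <= 0.
  under eq_bigr do rewrite mulrBr.
  by rewrite sumrB -mulr_suml p1 mul1r subr_le0.
have ge0 v : 0 <= p v * (f v - M) by rewrite mulr_ge0// subr_ge0 ltW.
move=> le0; have : \sum_v p v * (f v - M) == 0.
  by rewrite eq_le le0 sumr_ge0.
rewrite psumr_eq0//.
move=> /allP p_eq0; have := p1; rewrite big1 => [/esym/eqP|v _].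
  by rewrite oner_eq0.
have /p_eq0 := mem_index_enum v; rewrite /= mulf_eq0 subr_eq0 (gt_eqF (fgt v)) orbF.
by move/eqP.
Qed.

End Averages.

(** * Exponential moments and maxima of Rademacher sums *)

Section Exponential.
Context {R : realType}.

(** Multiply [1 - w <= expR (- w)] by [expR w] and use (1 - w)(1 + w + 2 w^2) = 1 + w^2 (1 - 2 w) >=
    1. *)
Lemma expR_le_quadratic (w : R) : w <= 2^-1 -> expR w <= 1 + w + 2 * w ^+ 2.
Proof.
move=> w1; have w2 := expR_ge1Dx (- w).
have: expR w * expR (- w) = 1 by exact: expRxMexpNx_1.
have e0 := expR_gt0 w; nra.
Qed.

(** For small [w] the linear terms of the two quadratic bounds cancel; for |w| > 1/2 each exponent
    is at most |w| <= 2 w^2. *)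
Lemma expR_cosh (w : R) : expR w + expR (- w) <= 2 * expR (2 * w ^+ 2).
Proof.
have [w1|w1] := lerP (`|w|) (2^-1).
  have := expR_le_quadratic (w := w); have := expR_le_quadratic (w := - w).
  have := expR_ge1Dx (2 * w ^+ 2); rewrite sqrrN.
  by move: w1; rewrite ler_norml; lra.
have h x : `|x| = `|w| -> expR x <= expR (2 * w ^+ 2).
  move=> xw; rewrite ler_expR (le_trans (ler_norm x))// xw -real_normK ?num_real//.
  by nra.
by have := h w erefl; have := h (- w) (normrN w); lra.
Qed.

Lemma avg_bool (F : bool -> R) : avg F = 2^-1 * (F true + F false).
Proof. by rewrite /avg card_bool big_bool. Qed.

Lemma rademacher_mgf k (a : 'I_k -> R) :
  avg (fun e : {ffun 'I_k -> bool} => expR (\sum_i (-1) ^+ e i * a i)) <=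
  expR (2 * \sum_i a i ^+ 2).
Proof.
under eq_avg do rewrite expR_sum.
rewrite (avg_prod (fun i (b : bool) => expR ((-1) ^+ b * a i))) mulr_sumr expR_sum.
apply: ler_prod => i _; rewrite avg_bool mulr_ge0 ?addr_ge0 ?expR_ge0//=.
rewrite expr1 expr0 mulN1r mul1r.
by have := expR_cosh (a i); lra.
Qed.

(** Maximal inequality for finitely many subgaussian sums: the maximum is dominated by the sum of
    all two-sided exponentials at the parameter [l], whose average is controlled by
    [rademacher_mgf]. *)
Lemma rademacher_max (P : finType) k (a : P -> 'I_k -> R) (sigma L : R) :
  0 < sigma -> 0 < L -> (forall p, \sum_i a p i ^+ 2 <= sigma ^+ 2) ->
  ln (2 * #|P|%:R) <= L ->
  exists G : {ffun 'I_k -> bool} -> R,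
    (forall (e : {ffun 'I_k -> bool}) p, `|\sum_i (-1) ^+ e i * a p i| <= G e) /\
    avg G <= 3 * sigma * Num.sqrt L.
Proof.
move=> s0 L0 a_sigma PL.
have sL0 : 0 < Num.sqrt L by rewrite sqrtr_gt0.
have sL2 : Num.sqrt L ^+ 2 = L by rewrite sqr_sqrtr// ltW.
set l := Num.sqrt L / sigma; have l0 : 0 < l by rewrite divr_gt0.
pose Z p (e : {ffun 'I_k -> bool}) := \sum_i (-1) ^+ e i * a p i.
(* The average of the sum [S] below is at most 2 #|P| exp(2 L) <= exp(3 L), so a tangent taken at 3
   L leaves the bound c / l = 3 sigma sqrt L. *)
pose c := 3 * L.
(* x <= c - 1 + expR (x - c) replaces the convexity of the exponential *)
have tangent (x : R) : x <= c - 1 + expR (- c) * expR x.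
  by rewrite -expRD addrC; have := expR_ge1Dx (- c + x); lra.
pose S e := \sum_p (expR (l * Z p e) + expR (- (l * Z p e))).
exists (fun e => l^-1 * (c - 1 + expR (- c) * S e)); split.
  move=> e p; rewrite mulrC ler_pdivlMr// mulrC.
  have Sp : expR (l * Z p e) + expR (- (l * Z p e)) <= S e.
    rewrite /S (bigD1 p)//= lerDl; apply: sumr_ge0 => q _.
    by apply: addr_ge0; exact: expR_ge0.
  have := ler_wpM2l (expR_ge0 (- c)) Sp.
  have := tangent (l * Z p e); have := tangent (- (l * Z p e)).
  have : 0 <= expR (- c) * expR (l * Z p e) by rewrite mulr_ge0 ?expR_ge0.
  have : 0 <= expR (- c) * expR (- (l * Z p e)) by rewrite mulr_ge0 ?expR_ge0.
  rewrite mulrDr => h1 h2 h3 h4 h5.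
  rewrite -[X in X * _](gtr0_norm l0) -normrM ler_norml.
  by rewrite -/(Z p e); apply/andP; split; lra.
have e0 : {ffun 'I_k -> bool} by exact: [ffun=> true].
rewrite avgZ avgD (avg_cst e0) avgZ.
have mgf p (s : R) : `|s| = l ->
    avg (fun e => expR (s * Z p e)) <= expR (2 * L).
  move=> sl; under eq_avg => e.
    rewrite /Z mulr_sumr; under eq_bigr do rewrite mulrCA.
    over.
  apply: (le_trans (rademacher_mgf _)); rewrite ler_expR ler_pM2l//.
  under eq_bigr do rewrite exprMn.
  rewrite -mulr_sumr -real_normK ?num_real// sl.
  rewrite (le_trans (ler_wpM2l _ (a_sigma p))) ?sqr_ge0//.
  by rewrite -exprMn /l divfK ?gt_eqF// sL2.
have avgS : avg S <= expR c.
  rewrite avg_sum.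
  apply: (@le_trans _ _ (\sum_(p : P) 2 * expR (2 * L))).
    apply: ler_sum => p _; rewrite avgD.
    have := mgf p l (gtr0_norm l0).
    have : avg (fun e => expR (- (l * Z p e))) <= expR (2 * L).
      rewrite (eq_avg (G := fun e => expR (- l * Z p e))).
        by apply: mgf; rewrite normrN gtr0_norm.
      by move=> e; rewrite mulNr.
    by lra.
  rewrite sumr_const -[_ *+ _]mulr_natl mulrA.
  have [->|P0] := posnP #|P|; first by rewrite !mul0r expR_ge0.
  rewrite /c (_ : 3 * L = L + 2 * L) ?expRD; last by ring.
  apply: ler_wpM2r; first exact: expR_ge0.
  by rewrite mulrC -[leLHS]lnK ?ler_expR// posrE mulr_gt0// ltr0n.
have : expR (- c) * avg S <= 1.
  by rewrite -[leRHS](expRxMexpNx_1 c) mulrC ler_wpM2r ?expR_ge0.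
move=> h; rewrite (@le_trans _ _ (l^-1 * c))//.
  by apply: ler_wpM2l; [rewrite invr_ge0 ltW|lra].
rewrite /l /c invf_div -[in 3 * L]sL2 le_eqVlt; apply/orP; left; apply/eqP.
by field; rewrite !gt_eqF.
Qed.

End Exponential.

(** * Maurey's empirical method and nets of the l1 ball *)

Section Maurey.
Context {R : realType}.

Lemma big_option_signed (I : finType) (F : option (I * bool) -> R) :
  \sum_v F v = F None + \sum_i (F (Some (i, true)) + F (Some (i, false))).
Proof.
rewrite (bigD1 None)//=; congr (_ + _).
rewrite (reindex_omap Some id) /=; last by case.
transitivity (\sum_(t : I * bool) F (Some (t.1, t.2))).
  by apply: eq_big => [|[i b]] // t; rewrite eqxx.
rewrite -(pair_bigA _ (fun i b => F (Some (i, b)))) /=.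
by apply: eq_bigr => i _; rewrite big_bool.
Qed.

(** The mean-zero hypothesis kills the linear term of [expR_le_quadratic], which applies since |l w|
    <= 1/2; the 8 is 2 times the bound 4 on w^2. *)
Lemma mean_zero_mgf (V : finType) (p w : V -> R) (l : R) :
  (forall v, 0 <= p v) -> \sum_v p v = 1 -> \sum_v p v * w v = 0 ->
  (forall v, `|w v| <= 2) -> `|l| <= 4^-1 ->
  \sum_v p v * expR (l * w v) <= expR (8 * l ^+ 2).
Proof.
move=> p0 p1 pw w2 l4.
have lw v : `|l * w v| <= 2^-1.
  rewrite normrM (le_trans (ler_pM _ _ l4 (w2 v)))//; lra.
apply: (@le_trans _ _ (\sum_v (p v * (1 + 8 * l ^+ 2) + l * (p v * w v)))).
  apply: ler_sum => v _; rewrite (mulrCA l) -mulrDr ler_wpM2l//.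
  apply: (le_trans (expR_le_quadratic (le_trans (ler_norm _) (lw v)))).
  have : `|w v| ^+ 2 <= 4 by have := w2 v; have := normr_ge0 (w v); nra.
  rewrite real_normK ?num_real// exprMn.
  by have := sqr_ge0 l; nra.
rewrite big_split /= -mulr_suml -mulr_sumr p1 pw mulr0 addr0 mul1r.
exact: expR_ge1Dx.
Qed.

(** Method of conditional expectations: drawing one more sample from [p] multiplies the mean
    potential by at most exp(8 l^2), so some sample does no worse. All k coordinates are handled by
    the same sample because their exponentials are summed. *)
Lemma maurey_potential k (V : finType) (p : V -> R) (w : 'I_k -> V -> R) (l : R) :
  (forall v, 0 <= p v) -> \sum_v p v = 1 ->
  (forall i, \sum_v p v * w i v = 0) -> (forall i v, `|w i v| <= 2) ->
  `|l| <= 4^-1 -> forall N, exists c : N.-tuple V,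
  \sum_i (expR (l * \sum_(v <- c) w i v) + expR (- l * \sum_(v <- c) w i v)) <=
  2 * k%:R * expR (8 * l ^+ 2 * N%:R).
Proof.
move=> p0 p1 pw w2 l4; elim=> [|N [c IH]].
  exists [tuple]; under eq_bigr do rewrite big_nil !mulr0 expR0.
  by rewrite sumr_const card_ord mulr0 expR0 mulr1 -[_ *+ k]mulr_natr; lra.
pose E (s : R) i := expR (s * \sum_(v <- c) w i v).
pose f v := \sum_i (E l i * expR (l * w i v) + E (- l) i * expR (- l * w i v)).
have E0 s i : 0 <= E s i by exact: expR_ge0.
have [|v fv] := weighted_exists_le p0 p1
  (M := 2 * k%:R * expR (8 * l ^+ 2 * N%:R) * expR (8 * l ^+ 2)) (f := f).
  apply: (@le_trans _ _ (\sum_i (E l i + E (- l) i) * expR (8 * l ^+ 2))).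
    rewrite /f; under eq_bigr do rewrite mulr_sumr.
    rewrite exchange_big; apply: ler_sum => i _ /=.
    under eq_bigr do rewrite mulrDr !(mulrCA (p _)).
    rewrite big_split /= -!mulr_sumr mulrDl; apply: lerD; apply: ler_wpM2l => //.
      exact: mean_zero_mgf.
    by rewrite -sqrrN mean_zero_mgf// normrN.
  by rewrite -mulr_suml ler_wpM2r ?expR_ge0.
exists [tuple of v :: c].
rewrite -[X in 8 * l ^+ 2 * X]natr1 mulrDr mulr1 expRD mulrA.
apply: le_trans fv.
apply: ler_sum => i _; rewrite big_cons !mulrDr !expRD.
by rewrite [X in X + _]mulrC [X in _ + X]mulrC.
Qed.

Lemma maurey k (V : finType) (p : V -> R) (f : 'I_k -> V -> R) (N : nat) (u : R) :
  (forall v, 0 <= p v) -> \sum_v p v = 1 -> (forall i v, `|f i v| <= 1) ->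
  0 < u <= 1 -> 32 * ln (2 * k%:R) <= u ^+ 2 * N%:R -> (0 < N)%N ->
  exists c : N.-tuple V, forall i,
    `|\sum_v p v * f i v - N%:R^-1 * \sum_(v <- c) f i v| <= u.
Proof.
move=> p0 p1 f1 /andP[u0 u1] uN N0.
pose m i := \sum_v p v * f i v.
have m1 i : `|m i| <= 1.
  rewrite (le_trans (ler_norm_sum _ _ _))// -p1; apply: ler_sum => v _.
  by rewrite normrM (ger0_norm (p0 v)) ler_piMr.
pose w i v := m i - f i v.
have w2 i v : `|w i v| <= 2.
  by rewrite (le_trans (ler_normB _ _))//; have := m1 i; have := f1 i v; lra.
have pw i : \sum_v p v * w i v = 0.
  under eq_bigr do rewrite mulrBr.
  by rewrite sumrB -mulr_suml p1 mul1r subrr.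
(* With l = u / 16, taking logarithms gives an error of at most ln(2k) / (l N) + 8 l, and each of
   the two terms is at most u / 2. *)
have l4 : `|u / 16| <= 4^-1 by rewrite gtr0_norm ?divr_gt0//; lra.
have [c cP] := maurey_potential p0 p1 pw w2 l4 N; exists c => i.
have k0 : (0 < k)%N by case: k i {f f1 uN m m1 w w2 pw cP} => // -[].
have NR0 : 0 < N%:R :> R by rewrite ltr0n.
set s := \sum_(v <- c) w i v in cP.
have -> : m i - N%:R^-1 * \sum_(v <- c) f i v = N%:R^-1 * s.
  rewrite /s sumrB big_const_seq count_predT size_tuple iter_addr_0.
  by rewrite mulrBr -[m i *+ N]mulr_natl mulKf ?gt_eqF.
have bound (z : R) : expR z <= 2 * k%:R * expR (8 * (u / 16) ^+ 2 * N%:R) ->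
    z <= ln (2 * k%:R) + 8 * (u / 16) ^+ 2 * N%:R.
  by rewrite -[2 * k%:R]lnK ?posrE ?mulr_gt0 ?ltr0n// -expRD ler_expR lnK // posrE mulr_gt0 ?ltr0n.
have si (z : R) : z = u / 16 \/ z = - (u / 16) ->
    z * s <= ln (2 * k%:R) + 8 * (u / 16) ^+ 2 * N%:R.
  move=> zu; apply: bound; apply: le_trans cP.
  rewrite (bigD1 i)//= -/s (@le_trans _ _ (expR (u / 16 * s) + expR (- (u / 16) * s)))//.
    by case: zu => ->; rewrite ?lerDl ?lerDr expR_ge0.
  by rewrite lerDl sumr_ge0// => j _; rewrite addr_ge0 ?expR_ge0.
have := si _ (or_introl erefl); have := si _ (or_intror erefl).
move=> h1 h2; rewrite mulrC normrM normfV [`|N%:R|]gtr0_norm// ler_pdivrMr// ler_norml.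
apply/andP; split; rewrite -(ler_pM2l u0); nra.
Qed.

Definition dot n (a x : 'I_n -> R) : R := \sum_j a j * x j.

(** The functional [a] at a vertex (-1)^b e_j of the l1 ball; [None] stands for the origin, which
    absorbs the mass missing when the l1 norm is below 1. *)
Definition signed_coord n (a : 'I_n -> R) (v : option ('I_n * bool)) : R :=
  if v is Some (j, b) then (-1) ^+ b * a j else 0.

Lemma l1_maurey k n (phi : 'I_k -> 'I_n -> R) (x : 'I_n -> R) (N : nat) (u : R) :
  (forall i j, `|phi i j| <= 1) -> \sum_j `|x j| <= 1 ->
  0 < u <= 1 -> 32 * ln (2 * k%:R) <= u ^+ 2 * N%:R -> (0 < N)%N ->
  exists c : N.-tuple (option ('I_n * bool)), forall i,
    `|dot (phi i) x - N%:R^-1 * \sum_(v <- c) signed_coord (phi i) v| <= u.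
Proof.
move=> phi1 x1 u01 uN N0.
(* x is the mean of the random vector equal to (-1)^b e_j with probability
   (|x_j| + (-1)^b x_j) / 2 and to 0 otherwise *)
pose p (v : option ('I_n * bool)) : R :=
  if v is Some (j, b) then (`|x j| + (-1) ^+ b * x j) / 2
  else 1 - \sum_j `|x j|.
have p0 v : 0 <= p v.
  case: v => [[j b]|] /=; last by rewrite subr_ge0.
  rewrite divr_ge0//; have := ler_norm (x j); have := ler_norm (- x j).
  by rewrite normrN; case: b; rewrite ?expr1 ?expr0; lra.
have p1 : \sum_v p v = 1.
  rewrite big_option_signed -[RHS](subrK (\sum_j `|x j|)); congr (_ + _).
  by apply: eq_bigr => j _ /=; field.
have f1 i v : `|signed_coord (phi i) v| <= 1.
  by case: v => [[j b]|] /=; rewrite ?normr0// normrM normrX normrN1 expr1n mul1r.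
have [c cP] := maurey p0 p1 f1 u01 uN N0; exists c => i.
have -> : dot (phi i) x = \sum_v p v * signed_coord (phi i) v; last exact: cP.
rewrite big_option_signed /= mulr0 add0r; apply: eq_bigr => j _; rewrite expr0 expr1; by field.
Qed.

(** Empirical means need not lie in [T], so each is replaced by a point of [T] close to it, which
    doubles the radius. Indexing by tuples gives the cardinality (2n + 1)^N. *)
Lemma l1_net k n (phi : 'I_k -> 'I_n -> R) (T : ('I_n -> R) -> Prop)
    (x0 : 'I_n -> R) (N : nat) (u : R) :
  (forall i j, `|phi i j| <= 1) -> (forall x, T x -> \sum_j `|x j| <= 1) ->
  T x0 -> 0 < u <= 1 -> 32 * ln (2 * k%:R) <= u ^+ 2 * N%:R -> (0 < N)%N ->
  exists g : N.-tuple (option ('I_n * bool)) -> 'I_n -> R,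
    (forall c, T (g c)) /\
    forall x, T x -> exists c, forall i, `|dot (phi i) x - dot (phi i) (g c)| <= 2 * u.
Proof.
move=> phi1 T1 Tx0 u01 uN N0.
pose near (x : 'I_n -> R) (c : N.-tuple (option ('I_n * bool))) := forall i,
  `|dot (phi i) x - N%:R^-1 * \sum_(v <- c) signed_coord (phi i) v| <= u.
(* A tuple with no point of [T] nearby receives the default [x0]. *)
have pick c : exists y, T y /\ forall x, T x -> near x c -> near y c.
  have [[y [Ty yc]]|no] := pselect (exists y, T y /\ near y c).
    by exists y.
  by exists x0; split=> // x Tx xc; case: no; exists x.
have [g gP] := choice pick; exists g; split=> [c|x Tx]; first by case: (gP c).
have [c cP] := l1_maurey phi1 (T1 x Tx) u01 uN N0; exists c => i.
have [_ /(_ x Tx cP) gc] := gP c.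
by have := cP i; have := gc i; rewrite !ler_norml; lra.
Qed.

End Maurey.

(** * Dyadic chaining over the nets *)

Section Chaining.
Context {R : realType}.

(** Induction on the level: each point of the new net is linked to a point of the previous net, and
    [rademacher_max] bounds all links at once. Link size halves from level to level while the square
    root of the entropy doubles, so every level costs the same 24 S sqrt K. *)
Lemma chaining k n (phi : 'I_k -> 'I_n -> R) (S : R) (D : nat) (K : R)
    (T : ('I_n -> R) -> Prop) :
  (forall i j, `|phi i j| <= 1) -> 0 < S -> (0 < D)%N ->
  (forall x, T x -> \sum_j `|x j| <= 1) ->
  (forall x, T x -> \sum_i dot (phi i) x ^+ 2 <= S ^+ 2) -> T (fun=> 0) ->
  32 * ln (2 * k%:R) <= D%:R :> R -> ln 2 + D%:R * ln (2 * n%:R + 1) <= K ->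
  forall J : nat, exists (P : finType) (g : P -> 'I_n -> R)
    (G : {ffun 'I_k -> bool} -> R),
    [/\ forall p, T (g p),
        forall x, T x -> exists p, forall i,
          `|dot (phi i) x - dot (phi i) (g p)| <= 2 * 2^-1 ^+ J,
        forall (e : {ffun 'I_k -> bool}) p,
          `|\sum_i (-1) ^+ e i * dot (phi i) (g p) ^+ 2| <= G e &
        avg G <= J%:R * (24 * S * Num.sqrt K)].
Proof.
move=> phi1 S0 D0 T1 TS T0 Dk DK.
have K0 : 0 < K.
  apply: lt_le_trans DK; rewrite ltr_pwDl ?ln_gt0 ?ltr1n//.
  by rewrite mulr_ge0 ?ln_ge0// lerDr mulr_ge0.
have dot1 i x : T x -> `|dot (phi i) x| <= 1.
  move=> /T1; apply: le_trans; rewrite (le_trans (ler_norm_sum _ _ _))//.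
  by apply: ler_sum => j _; rewrite normrM ler_piMl.
elim=> [|J [P [g [G [gT gnet gG avgG]]]]].
  (* At level 0 the single point 0 is a net, every functional being at most 1 on [T]. *)
  exists unit, (fun _ _ => 0), (fun=> 0).
  have dot0 i : dot (phi i) (fun=> 0) = 0 :> R.
    by rewrite /dot big1// => j _; rewrite mulr0.
  split=> //.
  - by move=> x /dot1 x1; exists tt => i; rewrite dot0 subr0 (le_trans (x1 i))//; lra.
  - by move=> e _; rewrite big1 ?normr0// => i _; rewrite dot0 expr0n mulr0.
  - by rewrite mul0r /avg big1 ?mulr0.
set u : R := 2^-1 ^+ J.+1.
have u0 : 0 < u by rewrite exprn_gt0.
have u1 : u <= 1 by rewrite exprn_ile1// invf_le1 ?ler1n.
have uJ : 2^-1 ^+ J = 2 * u :> R by rewrite /u exprS; field.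
(* This sample size makes u^2 N equal to [D], the threshold of Maurey's method at every scale. *)
pose N := (D * 4 ^ J.+1)%N.
have u4 : u ^+ 2 * 4 ^+ J.+1 = 1.
  rewrite /u -exprM mulnC exprM -exprMn -[RHS](expr1n _ J.+1); congr (_ ^+ _).
  by rewrite expr2; field.
have uN : u ^+ 2 * N%:R = D%:R by rewrite /N natrM natrX mulrCA u4 mulr1.
have N0 : (0 < N)%N by rewrite muln_gt0 D0 expn_gt0.
have u01 : 0 < u <= 1 by rewrite u0.
have DN : 32 * ln (2 * k%:R) <= u ^+ 2 * N%:R by rewrite uN.
have [h [hT hnet]] := l1_net phi1 T1 T0 u01 DN N0.
have [q qP] := choice (fun c => gnet _ (hT c)).
pose a c i := dot (phi i) (h c) ^+ 2 - dot (phi i) (g (q c)) ^+ 2.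
(* Factor the difference of squares as (a - b)(a + b): the first factor is at most 2 * 2^-J = 4 u,
   and (a + b)^2 <= 2 (a^2 + b^2) sums to at most 4 S^2. *)
have a_u c : \sum_i a c i ^+ 2 <= (8 * u * S) ^+ 2.
  apply: (@le_trans _ _ (\sum_i (4 * u) ^+ 2 * (2 * (dot (phi i) (h c) ^+ 2
                                  + dot (phi i) (g (q c)) ^+ 2)))).
    apply: ler_sum => i _; rewrite /a subr_sqr exprMn; apply: ler_pM.
    - exact: sqr_ge0.
    - exact: sqr_ge0.
    - rewrite -real_normK ?num_real// lerXn2r ?nnegrE// ?mulr_ge0//; first exact: ltW.
      by rewrite (le_trans (qP c i))// uJ; lra.
    - by have := sqr_ge0 (dot (phi i) (h c) - dot (phi i) (g (q c))); nra.
  rewrite -!mulr_sumr big_split /=.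
  have := TS _ (hT c); have := TS _ (gT (q c)); have := sqr_ge0 u.
  by rewrite !exprMn; nra.
pose L : R := K * 4 ^+ J.+1.
have PL : ln (2 * #|{: N.-tuple (option ('I_n * bool))}|%:R) <= L.
  rewrite card_tuple card_option card_prod card_ord card_bool natrX.
  rewrite lnM ?posrE ?exprn_gt0 ?ltr0n// lnXn ?ltr0n// -[ln _ *+ N]mulr_natl.
  rewrite -[(n * 2).+1%:R]natr1 (natrM _ n 2) [n%:R * _]mulrC /L.
  apply: (@le_trans _ _ ((ln 2 + D%:R * ln (2 * n%:R + 1)) * 4 ^+ J.+1)).
    rewrite [leRHS]mulrDl [X in _ <= _ + X]mulrAC -natrX -(natrM _ D) lerD2r.
    rewrite ler_peMr ?ln_ge0 ?ler1n//.
    by rewrite expn_gt0.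
  by rewrite ler_wpM2r// exprn_ge0.
have L0 : 0 < L by rewrite mulr_gt0// exprn_gt0.
have s0 : 0 < 8 * u * S by rewrite !mulr_gt0.
have [G' [G'a avgG']] := rademacher_max s0 L0 a_u PL.
exists {: N.-tuple (option ('I_n * bool))}, h, (fun e => G e + G' e); split=> //.
- move=> e c.
  have -> : \sum_i (-1) ^+ e i * dot (phi i) (h c) ^+ 2 =
      \sum_i (-1) ^+ e i * dot (phi i) (g (q c)) ^+ 2 + \sum_i (-1) ^+ e i * a c i.
    by rewrite -big_split; apply: eq_bigr => i _ /=; rewrite /a; ring.
  by rewrite (le_trans (ler_normD _ _))// lerD.
- rewrite avgD -natr1 mulrDl mul1r lerD// (le_trans avgG')//.
  rewrite /L sqrtrM ?(ltW K0)// (_ : 4 ^+ J.+1 = (2 ^+ J.+1) ^+ 2); last first.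
    by rewrite -exprM mulnC exprM -[2 ^+ 2]natrX.
  rewrite sqrtr_sqr ger0_norm ?exprn_ge0//.
  have u2 : u * 2 ^+ J.+1 = 1 by rewrite /u -exprMn mulVf ?expr1n.
  rewrite le_eqVlt; apply/orP; left; apply/eqP.
  transitivity (24 * S * Num.sqrt K * (u * 2 ^+ J.+1)); first by ring.
  by rewrite u2 mulr1.
Qed.

End Chaining.

(** * The signed process for a fixed choice of rows *)

Section RademacherProcess.
Context {R : realType}.

(** Off the diagonal, flipping the i-th sign preserves the uniform law and negates the product. *)
Lemma avg_signs k (i j : 'I_k) :
  avg (fun e : {ffun 'I_k -> bool} => (-1) ^+ e i * (-1) ^+ e j) = (i == j)%:R :> R.
Proof.
have [->|ij] := eqVneq i j.
  rewrite -[RHS](avg_cst ([ffun=> true] : {ffun 'I_k -> bool}) 1); apply: eq_avg => e.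
  by rewrite -expr2 sqrr_sign.
pose flip (e : {ffun 'I_k -> bool}) := [ffun l => (l == i) (+) e l].
have flipK : involutive flip.
  by move=> e; apply/ffunP => l; rewrite !ffunE addbA addbb.
set F := fun e : {ffun 'I_k -> bool} => _.
have : avg F = -1 * avg F.
  rewrite -avgZ -[LHS](avg_bij _ (inv_inj flipK)); apply: eq_avg => e.
  rewrite /F !ffunE eqxx eq_sym (negbTE ij) /= signrN.
  by ring.
by rewrite mulr0n; lra.
Qed.

Lemma avg_sign_sum_sqr k (P : pred 'I_k) :
  avg (fun e : {ffun 'I_k -> bool} => (\sum_(i | P i) (-1) ^+ e i) ^+ 2)
  = #|P|%:R :> R.
Proof.
under eq_avg => e.
  rewrite expr2 mulr_suml; under eq_bigr do rewrite mulr_sumr.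
  over.
rewrite avg_sum -sum1_card natr_sum; apply: eq_bigr => i Pi.
rewrite avg_sum (bigD1 i)//= avg_signs eqxx big1 ?addr0// => j /andP[_ ji].
by rewrite avg_signs eq_sym (negbTE ji).
Qed.

(* Repeated rows are grouped, so that the bound does not grow with k. *)
Lemma fine_scale_bound k n (psi : 'I_n -> 'I_n -> R) (r : 'I_k -> 'I_n) (S : R)
    (T : ('I_n -> R) -> Prop) :
  (0 < n)%N -> 0 < S ->
  (forall x, T x -> \sum_i dot (psi (r i)) x ^+ 2 <= S ^+ 2) ->
  exists G : {ffun 'I_k -> bool} -> R,
    (forall (e : {ffun 'I_k -> bool}) x y, T x -> T y ->
       (forall i, `|dot (psi (r i)) x - dot (psi (r i)) y| <= 2 / n%:R) ->
       `|\sum_i (-1) ^+ e i * (dot (psi (r i)) x ^+ 2 - dot (psi (r i)) y ^+ 2)|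
       <= G e) /\ avg G <= 4 * S.
Proof.
move=> n0 S0 TS.
pose c w : R := #|[pred i | r i == w]|%:R.
pose g w (e : {ffun 'I_k -> bool}) : R := \sum_(i | r i == w) (-1) ^+ e i.
have nR : 0 < n%:R :> R by rewrite ltr0n.
(* Here [c w] is the multiplicity of row [w] and [g w e] the sum of its signs, whose mean square is
   [c w]. Each of the n rows thus costs at most (2 / n) * 2 S on average; an absent row has inverse
   multiplicity 0. *)
exists (fun e => \sum_w 2 / n%:R * (S * (1 + g w e ^+ 2 * (c w)^-1))); split; last first.
  rewrite avg_sum; apply: (@le_trans _ _ (\sum_(w : 'I_n) 2 / n%:R * (S * 2))).
    apply: ler_sum => w _; rewrite !avgZ ler_wpM2l ?divr_ge0// ler_wpM2l ?(ltW S0)//.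
    rewrite avgD (avg_cst ([ffun=> true] : {ffun 'I_k -> bool})) avgZr avg_sign_sum_sqr -/(c w).
    have [->|cw] := eqVneq (c w) 0; first by rewrite mul0r; lra.
    by rewrite divff//; lra.
  rewrite sumr_const card_ord -mulr_natl le_eqVlt; apply/orP; left; apply/eqP.
  by field; rewrite gt_eqF.
move=> e x y Tx Ty xy.
pose d w := dot (psi w) x ^+ 2 - dot (psi w) y ^+ 2.
rewrite (partition_big r xpredT)//= (le_trans (ler_norm_sum _ _ _))//.
apply: ler_sum => w _.
have -> : \sum_(i | r i == w) (-1) ^+ e i *
    (dot (psi (r i)) x ^+ 2 - dot (psi (r i)) y ^+ 2) = g w e * d w.
  by rewrite mulr_suml; apply: eq_bigr => i /eqP ->.
have [c0|] := posnP #|[pred i | r i == w]|.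
  rewrite /g big_pred0 => [|i]; last exact: (card0_eq c0 i).
  by rewrite mul0r normr0 !mulr_ge0 ?invr_ge0 ?addr_ge0 ?mulr_ge0 ?invr_ge0 ?sqr_ge0// ltW.
move=> c0; have cw : 0 < c w by rewrite ltr0n.
have /card_gt0P[i0 /eqP ri0] := c0.
have xyw : `|dot (psi w) x - dot (psi w) y| <= 2 / n%:R by rewrite -ri0.
(* The energy of [z] contains [c w] copies of the same square, hence |<psi_w, z>| <= S / sqrt(c w);
   AM-GM then avoids the square root. *)
have amgm z : T z -> 2 * (`|dot (psi w) z| * `|g w e|) <= S * (1 + g w e ^+ 2 / c w).
  move=> /TS zS; set a := dot (psi w) z.
  have ca : c w * `|a| ^+ 2 <= S ^+ 2.
    rewrite real_normK ?num_real//; apply: le_trans zS.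
    rewrite (bigID (fun i => r i == w))/=.
    have -> : \sum_(i | r i == w) dot (psi (r i)) z ^+ 2 = c w * a ^+ 2.
      rewrite (eq_bigr (fun=> a ^+ 2)) => [|i /eqP ->]//.
      by rewrite sumr_const mulr_natl.
    by rewrite lerDl sumr_ge0// => i _; exact: sqr_ge0.
  rewrite -[g w e ^+ 2]real_normK ?num_real//; set b := `|g w e|.
  have b0 : 0 <= b by exact: normr_ge0.
  have a0 : 0 <= `|a| by exact: normr_ge0.
  rewrite -(ler_pM2r cw) -(ler_pM2l S0).
  have -> : S * (S * (1 + b ^+ 2 / c w) * c w) = S ^+ 2 * c w + S ^+ 2 * b ^+ 2.
    by field; rewrite gt_eqF.
  have := sqr_ge0 (c w * `|a| - S * b).
  have := ler_wpM2l (ltW cw) ca.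
  by lra.
rewrite normrM /d subr_sqr normrM.
rewrite mulrCA ler_pM ?mulr_ge0//.
have := amgm x Tx; have := amgm y Ty.
have := ler_wpM2l (normr_ge0 (g w e)) (ler_normD (dot (psi w) x) (dot (psi w) y)).
by lra.
Qed.

(** Chaining stops at level m, where the radius 2 * 2^-m is exactly the 2 / n that
    [fine_scale_bound] accepts. *)
Lemma process_bound k m (psi : 'I_(2 ^ m) -> 'I_(2 ^ m) -> R)
    (r : 'I_k -> 'I_(2 ^ m)) (S : R) (D : nat) (K : R) :
  (forall w j, `|psi w j| <= 1) -> 0 < S -> (0 < D)%N ->
  32 * ln (2 * k%:R) <= D%:R :> R -> ln 2 + D%:R * ln (2 * (2 ^ m)%:R + 1) <= K ->
  exists G : {ffun 'I_k -> bool} -> R,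
    (forall (e : {ffun 'I_k -> bool}) x, \sum_j `|x j| <= 1 ->
       \sum_i dot (psi (r i)) x ^+ 2 <= S ^+ 2 ->
       `|\sum_i (-1) ^+ e i * dot (psi (r i)) x ^+ 2| <= G e) /\
    avg G <= m%:R * (24 * S * Num.sqrt K) + 4 * S.
Proof.
move=> psi1 S0 D0 Dk DK.
pose T (x : 'I_(2 ^ m) -> R) :=
  \sum_j `|x j| <= 1 /\ \sum_i dot (psi (r i)) x ^+ 2 <= S ^+ 2.
have T0 : T (fun=> 0).
  split; first by rewrite big1 ?ler01// => j _; rewrite normr0.
  rewrite big1 ?sqr_ge0// => i _; rewrite /dot big1 ?expr0n// => j _.
  by rewrite mulr0.
have TS x : T x -> \sum_i dot (psi (r i)) x ^+ 2 <= S ^+ 2 by case.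
have T1 x : T x -> \sum_j `|x j| <= 1 by case.
have [P [g [G [gT gnet gG avgG]]]] :=
  chaining (phi := fun i => psi (r i)) (fun i => psi1 (r i)) S0 D0 T1 TS T0 Dk DK m.
have n0 : (0 < 2 ^ m)%N by rewrite expn_gt0.
have [G' [G'P avgG']] := fine_scale_bound n0 S0 TS.
exists (fun e => G e + G' e); split; last by rewrite avgD lerD.
move=> e x x1 xS; have Tx : T x by split.
have [p xp] := gnet x Tx.
have -> : \sum_i (-1) ^+ e i * dot (psi (r i)) x ^+ 2 =
    \sum_i (-1) ^+ e i * dot (psi (r i)) (g p) ^+ 2 +
    \sum_i (-1) ^+ e i * (dot (psi (r i)) x ^+ 2 - dot (psi (r i)) (g p) ^+ 2).
  by rewrite -big_split; apply: eq_bigr => i _ /=; ring.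
rewrite (le_trans (ler_normD _ _))// lerD//; apply: G'P => // i.
by rewrite natrX -exprVn.
Qed.

End RademacherProcess.

(** * Symmetrization, and Jensen's inequality for the square root *)

Section Symmetrization.
Context {R : realType}.

Lemma avg_pair (S T : finType) (F : S * T -> R) :
  avg (fun s => avg (fun t => F (s, t))) = avg F.
Proof.
rewrite /avg -mulr_sumr mulrA card_prod natrM invfM; congr (_ * _).
by rewrite pair_bigA; apply: eq_bigr => -[].
Qed.

(** The mean is replaced by an independent copy of the sample, and random swaps between the two
    samples introduce the signs. [F] plays the supremum: it is known only as a lower bound of all
    majorants. *)
Lemma symmetrization k n (X : Type) (T : X -> Prop) (h : X -> 'I_n -> R)
    (G : {ffun 'I_k -> 'I_n} -> {ffun 'I_k -> bool} -> R)
    (F : {ffun 'I_k -> 'I_n} -> R) :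
  (0 < n)%N ->
  (forall (r : {ffun 'I_k -> 'I_n}) (e : {ffun 'I_k -> bool}) x, T x ->
     `|\sum_i (-1) ^+ e i * h x (r i)| <= G r e) ->
  (forall (r : {ffun 'I_k -> 'I_n}) M,
     (forall x, T x -> `|\sum_i (avg (h x) - h x (r i))| <= M) -> F r <= M) ->
  avg F <= 2 * avg (fun r => avg (G r)).
Proof.
move=> n0 hG FM.
pose rT := {ffun 'I_k -> 'I_n}; pose eT := {ffun 'I_k -> bool}.
have r0 : rT by exact: [ffun=> Ordinal n0].
have e0 : eT by exact: [ffun=> true].
(* For fixed [e] the swap is an involution of pairs of samples, so it preserves their uniform
   law. *)
pose sw (e : eT) (p : rT * rT) : rT * rT :=
  ([ffun i => if e i then p.2 i else p.1 i],
   [ffun i => if e i then p.1 i else p.2 i]).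
have swK e : involutive (sw e).
  by move=> [r s]; congr (_, _); apply/ffunP => i; rewrite !ffunE /= ?ffunE; case: (e i).
(* A swap at i reverses the i-th difference, so the unsigned sum for [p] is the signed sum for
   [sw e p], for every [e]. Averaging over [e] thus keeps a majorant. *)
pose H p := avg (fun e => G (sw e p).1 e + G (sw e p).2 e).
have HP (p : rT * rT) x : T x -> `|\sum_i (h x (p.2 i) - h x (p.1 i))| <= H p.
  move=> Tx; rewrite -[leLHS](avg_cst e0); apply: le_avg => e.
  have -> : \sum_i (h x (p.2 i) - h x (p.1 i)) =
      \sum_i (-1) ^+ e i * h x ((sw e p).2 i) - \sum_i (-1) ^+ e i * h x ((sw e p).1 i).
    rewrite -sumrB; apply: eq_bigr => i _; rewrite !ffunE.
    by case: (e i); rewrite ?expr0 ?expr1; ring.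
  by rewrite (le_trans (ler_normB _ _))// addrC lerD// hG.
have FH r : F r <= avg (fun s => H (r, s)).
  apply: FM => x Tx.
  have -> : \sum_i (avg (h x) - h x (r i)) =
      avg (fun s : rT => \sum_i (h x (s i) - h x (r i))).
    rewrite avg_sum; apply: eq_bigr => i _.
    by rewrite avgD (avg_cst r0) avg_coord// card_ord.
  rewrite /avg normrM ger0_norm ?invr_ge0// ler_wpM2l ?invr_ge0//.
  rewrite (le_trans (ler_norm_sum _ _ _))//; apply: ler_sum => s _.
  exact: (HP (r, s)).
apply: (le_trans (le_avg FH)); rewrite avg_pair [leLHS]avg_exchange.
have -> : avg (fun r => avg (G r)) = avg (fun e => avg (G^~ e)) by exact: avg_exchange.
rewrite -avgZ; apply: le_avg => e.
rewrite (avg_bij (fun p => G p.1 e + G p.2 e) (inv_inj (swK e))) avgD.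
rewrite -2!avg_pair /= (avg_cst r0).
under eq_avg do rewrite (avg_cst r0).
by lra.
Qed.

(** Average 2 c sqrt(F t) <= F t + c^2 with c^2 the mean of [F], then divide by c; if c = 0, [F]
    vanishes everywhere. *)
Lemma avg_sqrt_le (T : finType) (t0 : T) (F : T -> R) :
  (forall t, 0 <= F t) -> avg (fun t => Num.sqrt (F t)) <= Num.sqrt (avg F).
Proof.
move=> F0; set c := Num.sqrt (avg F).
have avgF0 : 0 <= avg F by rewrite mulr_ge0 ?invr_ge0 ?sumr_ge0.
have c2 : c ^+ 2 = avg F by rewrite sqr_sqrtr.
have s2 t : Num.sqrt (F t) ^+ 2 = F t by rewrite sqr_sqrtr.
have c0 : 0 <= c by exact: sqrtr_ge0.
have : avg (fun t => c * Num.sqrt (F t)) <= c * c.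
  apply: (@le_trans _ _ (avg (fun t => 2^-1 * (F t + c ^+ 2)))).
    by apply: le_avg => t; have := sqr_ge0 (Num.sqrt (F t) - c); have := s2 t; lra.
  by rewrite avgZ avgD (avg_cst t0) c2 -expr2 c2; lra.
rewrite avgZ; have [c_gt0|] := ltrP 0 c; first by rewrite ler_pM2l.
move=> c_le0 _; have c_eq0 : c = 0 by apply/eqP; rewrite eq_le c_le0.
rewrite c_eq0 /avg big1 ?mulr0// => t _.
have : avg F == 0 by rewrite -c2 c_eq0 expr0n.
rewrite mulf_eq0 invr_eq0 pnatr_eq0 -leqn0 leqNgt.
have -> : (0 < #|T|)%N by apply/card_gt0P; exists t0.
rewrite /= psumr_eq0// => /allP/(_ t (mem_index_enum t))/eqP ->.
by rewrite sqrtr0.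
Qed.

End Symmetrization.

(** * Orthogonality of the Hadamard columns *)

Section Hadamard.
Context {R : realType}.

Lemma binary_digits_inj m s t : (s < 2 ^ m)%N -> (t < 2 ^ m)%N ->
  (forall j, (j < m)%N -> odd (s %/ 2 ^ j) = odd (t %/ 2 ^ j)) -> s = t.
Proof.
elim: m s t => [|m IH] s t; first by rewrite !ltnS !leqn0 => /eqP -> /eqP ->.
rewrite expnS => sm tm st; rewrite (divn_eq s 2) (divn_eq t 2) !modn2.
have := st 0%N isT; rewrite !divn1 => ->; congr (_ * 2 + _)%N.
apply: IH; rewrite ?ltn_divLR 1?mulnC// => j jm.
by rewrite -!divnMA -expnS st.
Qed.

Definition digits m (w : 'I_(2 ^ m)) : {ffun 'I_m -> bool} :=
  [ffun j : 'I_m => odd (w %/ 2 ^ j)].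

Lemma digits_bij m : bijective (@digits m).
Proof.
apply: inj_card_bij; last by rewrite card_ffun card_bool !card_ord.
move=> s t /ffunP st; apply/val_inj/(binary_digits_inj (ltn_ord s) (ltn_ord t)).
by move=> j jm; have := st (Ordinal jm); rewrite !ffunE.
Qed.

Lemma hadamard_digits m (w t : 'I_(2 ^ m)) :
  hadamard R (2 ^ m) w t = \prod_j (-1) ^+ (digits w j && digits t j).
Proof.
rewrite mxE trunc_expnK// /bdot.
rewrite (big_morph (fun a : 'F_2 => (-1) ^+ (a : nat) : R) (id1 := 1) (op1 := *%R)) //.
  apply: eq_bigr => j _; rewrite !mxE !ffunE -natrM val_Fp_nat// modn2.
  by rewrite oddM.
move=> a b; rewrite -exprD -[RHS]signr_odd -modn2; congr (_ ^+ _).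
Qed.

Lemma hadamard_norm n (w t : 'I_n) : `|hadamard R n w t| = 1.
Proof. by rewrite mxE normrX normrN1 expr1n. Qed.

(** Summing over the digits of [w] independently factors the sum into m two-term sums; a digit where
    [s] and [t] differ contributes 1 - 1 = 0. *)
Lemma hadamard_orthogonal m (s t : 'I_(2 ^ m)) :
  \sum_w hadamard R (2 ^ m) w s * hadamard R (2 ^ m) w t = (2 ^ m)%:R * (s == t)%:R.
Proof.
have [->|st] := eqVneq s t.
  rewrite (eq_bigr (fun=> 1)) ?sumr_const ?card_ord ?mulr1// => w _.
  by rewrite -expr2 -real_normK ?num_real// hadamard_norm expr1n.
pose F j (b : bool) : R := (-1) ^+ (b && digits s j) * (-1) ^+ (b && digits t j).
transitivity (\sum_(f : {ffun 'I_m -> bool}) \prod_j F j (f j)).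
  rewrite (reindex (@digits m)) /=; last exact: onW_bij (digits_bij m).
  by apply: eq_bigr => w _; rewrite !hadamard_digits -big_split.
rewrite -bigA_distr_bigA /= mulr0; apply/eqP/prodf_eq0.
have [j stj] : exists j, digits s j != digits t j.
  apply: contrapT => no; move/eqP: st; apply; apply: (bij_inj (digits_bij m)).
  by apply/ffunP => j; apply/eqP/negPn/negP => stj; apply: no; exists j.
exists j => //; rewrite big_bool /F /=.
by case: (digits s j) (digits t j) stj => -[]; rewrite //= ?expr0 ?expr1 ?mulr1 ?mul1r ?addNr.
Qed.

Lemma hadamard_parseval m (x : 'I_(2 ^ m) -> R) :
  avg (fun w => dot (hadamard R (2 ^ m) w) x ^+ 2) = \sum_t x t ^+ 2.
Proof.
rewrite /avg card_ord; apply: (canLR (mulKf _)); first by rewrite pnatr_eq0 expn_eq0.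
under eq_bigr => w _.
  rewrite expr2 mulr_suml; under eq_bigr do rewrite mulr_sumr.
  over.
rewrite exchange_big mulr_sumr; apply: eq_bigr => s _ /=.
rewrite exchange_big (bigD1 s)//= [X in _ + X]big1 ?addr0 => [|t ts].
  under eq_bigr do rewrite mulrACA.
  by rewrite -mulr_suml hadamard_orthogonal eqxx mulr1 expr2.
under eq_bigr do rewrite mulrACA.
by rewrite -mulr_suml hadamard_orthogonal eq_sym (negbTE ts) mulr0 mul0r.
Qed.

End Hadamard.

(** * Spectral norm of a symmetric matrix through its quadratic form *)

Section SpectralNorm.
Context {R : realType}.

Definition inner n (x y : 'cV[R]_n) : R := (x^T *m y) ord0 ord0.

Lemma innerE n (x y : 'cV[R]_n) : inner x y = \sum_i x i ord0 * y i ord0.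
Proof. by rewrite /inner mxE; apply: eq_bigr => i _; rewrite mxE. Qed.

Lemma inner_sqr n (x : 'cV[R]_n) : inner x x = l2norm x ^+ 2.
Proof.
by rewrite innerE sqr_sqrtr ?sumr_ge0// => i _; exact: sqr_ge0.
Qed.

Lemma l2norm_ge0 n (x : 'cV[R]_n) : 0 <= l2norm x.
Proof. exact: sqrtr_ge0. Qed.

Lemma l2norm0 n : l2norm (0 : 'cV[R]_n) = 0.
Proof. by rewrite /l2norm big1 ?sqrtr0// => i _; rewrite mxE expr0n. Qed.

Lemma l2norm_eq0 n (x : 'cV[R]_n) : l2norm x = 0 -> x = 0.
Proof.
move=> x0; have := inner_sqr x; rewrite x0 expr0n innerE /= => /eqP.
rewrite psumr_eq0 => [/allP x_eq0|i _]; last by rewrite -expr2 sqr_ge0.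
apply/matrixP => i j; rewrite ord1 mxE.
by have /x_eq0 := mem_index_enum i; rewrite /= mulf_eq0 orbb => /eqP.
Qed.

Lemma l2normZ n (c : R) (x : 'cV[R]_n) : l2norm (c *: x) = `|c| * l2norm x.
Proof.
rewrite /l2norm; under eq_bigr do rewrite mxE exprMn.
by rewrite -mulr_sumr sqrtrM ?sqr_ge0// sqrtr_sqr.
Qed.

(** Cauchy-Schwarz, from termwise AM-GM with weights c and 1 / c for c the norm of [y]. *)
Lemma inner_le_l2norm n (x y : 'cV[R]_n) : l2norm x <= 1 -> `|inner x y| <= l2norm y.
Proof.
move=> x1; have x2 : inner x x <= 1.
  by rewrite inner_sqr expr_le1// l2norm_ge0.
have [y0|y0] := eqVneq (l2norm y) 0.
  by rewrite (l2norm_eq0 y0) /inner mulmx0 mxE normr0 l2norm_ge0.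
set c := l2norm y in y0 *.
have c0 : 0 < c by rewrite lt_neqAle eq_sym y0 l2norm_ge0.
rewrite innerE (le_trans (ler_norm_sum _ _ _))//.
apply: (@le_trans _ _ (\sum_i 2^-1 * (c * (x i ord0 * x i ord0) +
                                     c^-1 * (y i ord0 * y i ord0)))).
  apply: ler_sum => i _; rewrite normrM -!expr2.
  rewrite -[x i ord0 ^+ 2]real_normK ?num_real// -[y i ord0 ^+ 2]real_normK ?num_real//.
  rewrite -(ler_pM2r c0).
  set a := `|x i ord0|; set b := `|y i ord0|.
  have -> : 2^-1 * (c * a ^+ 2 + c^-1 * b ^+ 2) * c =
            2^-1 * ((c * a) ^+ 2 + b ^+ 2) by field.
  by have := sqr_ge0 (c * a - b); lra.
rewrite -mulr_sumr big_split /= -!mulr_sumr -!innerE (inner_sqr y) -/c.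
have -> : c^-1 * c ^+ 2 = c by field.
by have := ler_wpM2l (ltW c0) x2; lra.
Qed.

Lemma inner_trmx n (A : 'M[R]_n) (x y : 'cV[R]_n) :
  A^T = A -> inner x (A *m y) = inner y (A *m x).
Proof.
move=> AT; rewrite /inner -[x^T *m _]trmxK mxE.
by rewrite !trmx_mul trmxK AT mulmxA.
Qed.

(* By polarization the bilinear form is controlled by the quadratic form. *)
Lemma symmetric_l2norm_le n (A : 'M[R]_n) (M : R) : A^T = A ->
  (forall z, l2norm z <= 1 -> `|inner z (A *m z)| <= M) ->
  forall z, l2norm z <= 1 -> l2norm (A *m z) <= M.
Proof.
move=> AT AM z z1.
have M0 : 0 <= M.
  by apply: le_trans (AM 0 _); rewrite ?normr_ge0 ?l2norm0.
pose q x := inner x (A *m x).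
have qM x : `|q x| <= M * inner x x.
  have [x0|x0] := eqVneq (l2norm x) 0.
    by rewrite /q (l2norm_eq0 x0) /inner !mulmx0 mxE normr0 mulr0.
  set c := l2norm x in x0 *.
  have c0 : 0 < c by rewrite lt_neqAle eq_sym x0 l2norm_ge0.
  have /AM : l2norm (c^-1 *: x) <= 1.
    by rewrite l2normZ gtr0_norm ?invr_gt0// mulVf.
  have -> : inner (c^-1 *: x) (A *m (c^-1 *: x)) = q x / c ^+ 2.
    rewrite /q /inner linearZ /= -scalemxAl -!scalemxAr scalerA mxE.
    by rewrite -expr2 exprVn mulrC.
  by rewrite normrM normfV (ger0_norm (sqr_ge0 c)) ler_pdivrMr ?exprn_gt0// inner_sqr.
have polar x y : 4 * inner x (A *m y) = q (x + y) - q (x - y).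
  rewrite /q !(mulmxDr, mulmxN) /inner.
  rewrite !(linearD, linearN) /= !(mulmxDr, mulmxDl, mulmxN, mulNmx) !mxE.
  have := inner_trmx x y AT; rewrite /inner !mxE; lra.
have parallel (x y : 'cV[R]_n) : inner (x + y) (x + y) + inner (x - y) (x - y) =
    2 * (inner x x + inner y y).
  rewrite !innerE -!big_split /= mulr_sumr; apply: eq_bigr => i _ /=.
  by rewrite !mxE; ring.
have [Az0|Az0] := eqVneq (l2norm (A *m z)) 0; first by rewrite Az0.
set c := l2norm (A *m z) in Az0 *.
have c0 : 0 < c by rewrite lt_neqAle eq_sym Az0 l2norm_ge0.
(* For the unit vector y along A z, polarization and the parallelogram law give 4 c <= 2 M (1 +
   |z|^2) <= 4 M. *)
set y := c^-1 *: (A *m z).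
have yy : inner y y = 1.
  by rewrite inner_sqr l2normZ gtr0_norm ?invr_gt0// mulVf// expr1n.
have yA : inner y (A *m z) = c.
  rewrite /inner linearZ /= -scalemxAl mxE -/(inner _ _) inner_sqr -/c.
  by rewrite expr2 mulKf.
have zz : inner z z <= 1 by rewrite inner_sqr expr_le1// l2norm_ge0.
have := polar y z; rewrite yA => cq.
have := qM (y + z); have := qM (y - z); rewrite !ler_norml.
move=> /andP[h1 h2] /andP[h3 h4].
have := parallel y z; rewrite yy => par.
have : M * inner (y + z) (y + z) + M * inner (y - z) (y - z) <= M * 4.
  by rewrite -mulrDr par ler_wpM2l//; lra.
by lra.
Qed.

Lemma spectral_norm_le_symmetric n (A : 'M[R]_n) (M : R) : A^T = A ->
  (forall z, l2norm z <= 1 -> `|inner z (A *m z)| <= M) -> spectral_norm A <= M.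
Proof.
move=> AT AM; apply: ge_sup.
  by exists (l2norm (A *m 0)), 0 => //=; rewrite l2norm0.
by move=> _ [z z1 <-]; exact: symmetric_l2norm_le z1.
Qed.

(** The bound [M] only serves to make the set under [sup] bounded. *)
Lemma inner_le_spectral_norm n (A : 'M[R]_n) (M : R) (z : 'cV[R]_n) : A^T = A ->
  (forall z, l2norm z <= 1 -> `|inner z (A *m z)| <= M) -> l2norm z <= 1 ->
  `|inner z (A *m z)| <= spectral_norm A.
Proof.
move=> AT AM z1; apply: (le_trans (inner_le_l2norm _ z1)).
apply: ub_le_sup; last by exists z.
by exists M => _ [y y1 <-]; exact: symmetric_l2norm_le y1.
Qed.

End SpectralNorm.

(** * From matrices to the scalar deviation on test vectors *)

Section Deviation.
Context {R : realType}.
Context (n k : nat).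

Definition deviation (r : 'I_k -> 'I_n) (x : 'I_n -> R) : R :=
  \sum_t x t ^+ 2 - k%:R^-1 * \sum_i dot (hadamard R n (r i)) x ^+ 2.

(** Coordinatewise products merge the supremum over [y] and the one over [z] inside the spectral
    norm into one. *)
Definition test_vector (alpha : R) (x : 'I_n -> R) : Prop :=
  exists y z : 'cV[R]_n, [/\ l2norm y <= 1, `|y| <= alpha, l2norm z <= 1 &
    x = fun t => y t ord0 * z t ord0].

Lemma l2norm_le1 m (y : 'cV[R]_m) : l2norm y <= 1 -> \sum_t y t ord0 ^+ 2 <= 1.
Proof.
move=> y1; have <- : l2norm y ^+ 2 = \sum_t y t ord0 ^+ 2.
  by rewrite sqr_sqrtr// sumr_ge0// => t _; exact: sqr_ge0.
by rewrite expr_le1// l2norm_ge0.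
Qed.

Lemma test_vector_l1 alpha x : test_vector alpha x -> \sum_t `|x t| <= 1.
Proof.
move=> [y [z [/l2norm_le1 y1 _ /l2norm_le1 z1 ->]]].
apply: (@le_trans _ _ (\sum_t 2^-1 * (y t ord0 ^+ 2 + z t ord0 ^+ 2))).
  apply: ler_sum => t _; rewrite normrM.
  rewrite -[y t ord0 ^+ 2]real_normK ?num_real// -[z t ord0 ^+ 2]real_normK ?num_real//.
  by have := sqr_ge0 (`|y t ord0| - `|z t ord0|); lra.
by rewrite -mulr_sumr big_split /=; lra.
Qed.

Lemma entry_le_norm m (y : 'cV[R]_m) t : `|y t ord0| <= `|y|.
Proof. by rewrite /Num.norm /= mx_normrE (le_bigmax _ (fun ij => `|y ij.1 ij.2|) (t, ord0)). Qed.

Lemma test_vector_l2 alpha x : test_vector alpha x -> \sum_t x t ^+ 2 <= alpha ^+ 2.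
Proof.
move=> [y [z [_ ya /l2norm_le1 z1 ->]]].
apply: (@le_trans _ _ (\sum_t alpha ^+ 2 * z t ord0 ^+ 2)).
  apply: ler_sum => t _; rewrite exprMn ler_wpM2r ?sqr_ge0//.
  have := le_trans (entry_le_norm y t) ya; have := normr_ge0 (y t ord0).
  by rewrite -[y t ord0 ^+ 2]real_normK ?num_real//; nra.
by rewrite -mulr_sumr ler_piMr ?sqr_ge0.
Qed.

(** Both terms of the deviation lie in [0, 1]. This crude bound makes the suprema finite. *)
Lemma test_vector_deviation (r : 'I_k -> 'I_n) alpha x :
  test_vector alpha x -> `|deviation r x| <= 1.
Proof.
move=> /test_vector_l1 x1.
have xt t : `|x t| <= 1.
  by apply: le_trans x1; rewrite (bigD1 t)//= lerDl sumr_ge0.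
have x2 : \sum_t x t ^+ 2 <= 1.
  apply: le_trans x1; apply: ler_sum => t _.
  rewrite -[x t ^+ 2]real_normK ?num_real//.
  by have := xt t; have := normr_ge0 (x t); nra.
have x2_ge0 : 0 <= \sum_t x t ^+ 2 by rewrite sumr_ge0// => t _; exact: sqr_ge0.
have dx i : dot (hadamard R n (r i)) x ^+ 2 <= 1.
  rewrite -real_normK ?num_real// expr_le1//.
  apply: le_trans x1; rewrite (le_trans (ler_norm_sum _ _ _))//.
  by apply: ler_sum => j _; rewrite normrM hadamard_norm mul1r.
have d2 : k%:R^-1 * \sum_i dot (hadamard R n (r i)) x ^+ 2 <= 1.
  apply: (@le_trans _ _ (k%:R^-1 * \sum_(i < k) 1)).
    by rewrite ler_wpM2l ?invr_ge0// ler_sum.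
  rewrite sumr_const card_ord.
  have [->|k0] := eqVneq k 0%N; first by rewrite mulr0n mulr0.
  by rewrite mulVf// pnatr_eq0.
have d2_ge0 : 0 <= k%:R^-1 * \sum_i dot (hadamard R n (r i)) x ^+ 2.
  by rewrite mulr_ge0 ?invr_ge0 ?sumr_ge0// => i _; exact: sqr_ge0.
by rewrite /deviation ler_norml; lra.
Qed.

Definition deviation_mx (r : {ffun 'I_k -> 'I_n}) (y : 'cV[R]_n) : 'M[R]_n :=
  Dmx y ^+ 2 - k%:R^-1 *: (Dmx y *m (Phi R r)^T *m Phi R r *m Dmx y).

Lemma deviation_mx_sym r y : (deviation_mx r y)^T = deviation_mx r y.
Proof.
rewrite /deviation_mx expr2 -mulmxE linearB /= linearZ /= !trmx_mul trmxK.
by rewrite tr_diag_mx !mulmxA.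
Qed.

Lemma deviation_mx_inner r y z :
  inner z (deviation_mx r y *m z) = deviation r (fun t => y t ord0 * z t ord0).
Proof.
have Dz t : (Dmx y *m z) t ord0 = y t ord0 * z t ord0.
  by rewrite mul_diag_mx !mxE.
have -> : inner z (deviation_mx r y *m z) = inner (Dmx y *m z) (Dmx y *m z) -
    k%:R^-1 * inner (Phi R r *m (Dmx y *m z)) (Phi R r *m (Dmx y *m z)).
  rewrite /inner !trmx_mul tr_diag_mx /deviation_mx expr2 -mulmxE.
  by rewrite mulmxBl mulmxBr -scalemxAl -scalemxAr !mulmxA !mxE.
congr (_ - _ * _).
  by rewrite innerE; apply: eq_bigr => t _; rewrite Dz expr2.
rewrite innerE; apply: eq_bigr => i _; rewrite -expr2; congr (_ ^+ 2).
by rewrite mxE /dot; apply: eq_bigr => t _; rewrite Dz mxE.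
Qed.

Lemma sup_deviation_le (alpha : R) (r : {ffun 'I_k -> 'I_n}) (M : R) : 0 < alpha ->
  (forall x, test_vector alpha x -> `|deviation r x| <= M) ->
  sup_deviation alpha r <= M.
Proof.
move=> alpha0 rM; apply: ge_sup.
  exists (spectral_norm (deviation_mx r 0)), 0 => //; split => /=.
    by rewrite /B2 /= l2norm0.
  by rewrite /scaled_Binf /= normr0 ltW.
move=> _ [y [y1 ya] <-]; apply: spectral_norm_le_symmetric.
  exact: deviation_mx_sym.
move=> z z1; rewrite deviation_mx_inner; apply: rM.
by exists y, z.
Qed.

Lemma deviation_le_sup (alpha : R) (r : {ffun 'I_k -> 'I_n}) x :
  test_vector alpha x -> `|deviation r x| <= sup_deviation alpha r.
Proof.
have dev1 y z : l2norm y <= 1 -> `|y| <= alpha -> l2norm z <= 1 ->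
    `|inner z (deviation_mx r y *m z)| <= 1.
  move=> y1 ya z1; rewrite deviation_mx_inner.
  by apply: (@test_vector_deviation _ alpha); exists y, z.
move=> [y [z [y1 ya z1 ->]]]; rewrite -deviation_mx_inner.
apply: (@le_trans _ _ (spectral_norm (deviation_mx r y))).
  apply: (inner_le_spectral_norm (M := 1)) => //; first exact: deviation_mx_sym.
  by move=> z'; exact: dev1.
apply: ub_le_sup; last by exists y.
exists 1 => _ [y' [y'1 y'a] <-]; apply: spectral_norm_le_symmetric.
  exact: deviation_mx_sym.
by move=> z'; exact: dev1.
Qed.

End Deviation.

(** * Assembling the bound, constants, and the self-bounding inequality *)

Section ExpectedSup.
Context {R : realType}.

Lemma expected_supE n k (alpha : R) :
  expected_sup n k alpha =
  avg (fun r : {ffun 'I_k -> 'I_n} => sup_deviation alpha r).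
Proof.
rewrite /expected_sup -mulr_sumr prodr_const card_ord /avg card_ffun !card_ord.
by rewrite natrX exprVn.
Qed.

Lemma sup_deviation_ge0 n k (alpha : R) (r : {ffun 'I_k -> 'I_n}) :
  0 < alpha -> 0 <= sup_deviation alpha r.
Proof.
move=> alpha0.
have T0 : test_vector alpha (fun t : 'I_n => (0 : 'cV[R]_n) t ord0 * (0 : 'cV[R]_n) t ord0).
  by exists 0, 0; split=> //; rewrite ?l2norm0// normr0 ltW.
exact: le_trans (normr_ge0 _) (deviation_le_sup r T0).
Qed.

Lemma deviationE m k (r : 'I_k -> 'I_(2 ^ m)) (x : 'I_(2 ^ m) -> R) : (0 < k)%N ->
  deviation r x = k%:R^-1 * \sum_i
    (avg (fun w => dot (hadamard R (2 ^ m) w) x ^+ 2) -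
     dot (hadamard R (2 ^ m) (r i)) x ^+ 2).
Proof.
move=> k0; rewrite hadamard_parseval sumrB sumr_const card_ord mulrBr.
by rewrite -[(\sum_t _) *+ k]mulr_natl mulKf// pnatr_eq0 -lt0n.
Qed.

(** The source of self-bounding: the energy that scales the signed process is itself controlled by
    the deviation. *)
Lemma test_vector_energy n k (r : {ffun 'I_k -> 'I_n}) alpha (x : 'I_n -> R) :
  (0 < k)%N -> test_vector alpha x ->
  \sum_i dot (hadamard R n (r i)) x ^+ 2 <= k%:R * (sup_deviation alpha r + alpha ^+ 2).
Proof.
move=> k0 Tx; have kR : 0 < k%:R :> R by rewrite ltr0n.
rewrite -[leLHS](mulVKf (lt0r_neq0 kR)) ler_pM2l//.
have := deviation_le_sup r Tx; have := test_vector_l2 Tx.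
by rewrite /deviation ler_norml; lra.
Qed.

Lemma expected_sup_process m k (alpha : R) (D : nat) (K : R) :
  (0 < k)%N -> 0 < alpha -> (0 < D)%N ->
  32 * ln (2 * k%:R) <= D%:R :> R -> ln 2 + D%:R * ln (2 * (2 ^ m)%:R + 1) <= K ->
  expected_sup (2 ^ m) k alpha <= 2 * (m%:R * (24 * Num.sqrt K) + 4) /
    Num.sqrt k%:R * Num.sqrt (expected_sup (2 ^ m) k alpha + alpha ^+ 2).
Proof.
move=> k0 alpha0 D0 Dk DK; have kR : 0 < k%:R :> R by rewrite ltr0n.
set n := (2 ^ m)%N; have n0 : (0 < n)%N by rewrite expn_gt0.
set B := m%:R * (24 * Num.sqrt K) + 4.
have B0 : 0 <= B by rewrite addr_ge0// !mulr_ge0// sqrtr_ge0.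
pose E (r : {ffun 'I_k -> 'I_n}) := sup_deviation alpha r + alpha ^+ 2 : R.
have E0 (r : {ffun 'I_k -> 'I_n}) : 0 < E r.
  by rewrite ltr_wpDl ?exprn_gt0// sup_deviation_ge0.
pose S r := Num.sqrt (k%:R * E r).
have S0 (r : {ffun 'I_k -> 'I_n}) : 0 < S r by rewrite sqrtr_gt0 mulr_gt0.
have psi1 (w j : 'I_n) : `|hadamard R n w j| <= 1 by rewrite hadamard_norm.
have [G GP] := choice (fun r : {ffun 'I_k -> 'I_n} =>
  process_bound r psi1 (S0 r) D0 Dk DK).
have sym : avg (fun r : {ffun 'I_k -> 'I_n} => k%:R * sup_deviation alpha r) <=
    2 * avg (fun r => avg (G r)).
  apply: (symmetrization (T := test_vector alpha)
    (h := fun x w => dot (hadamard R n w) x ^+ 2)) => // [r e x Tx|r M rM].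
    case: (GP r) => + _; apply; first exact: test_vector_l1 Tx.
    by rewrite sqr_sqrtr ?test_vector_energy// mulr_ge0// ltW.
  rewrite mulrC -ler_pdivlMr//; apply: sup_deviation_le => // x Tx.
  rewrite deviationE// normrM ger0_norm ?invr_ge0// mulrC ler_pM2r ?invr_gt0//.
  exact: rM.
have r0 : {ffun 'I_k -> 'I_n} by exact: [ffun=> Ordinal n0].
have avgG : avg (fun r => avg (G r)) <= B * (Num.sqrt k%:R * Num.sqrt (avg E)).
  apply: (@le_trans _ _ (avg (fun r => B * Num.sqrt k%:R * Num.sqrt (E r)))).
    apply: le_avg => r; case: (GP r) => _ /le_trans; apply.
    have -> : B * Num.sqrt k%:R * Num.sqrt (E r) = B * S r.
      by rewrite /S sqrtrM// mulrA.
    by rewrite /B le_eqVlt; apply/orP; left; apply/eqP; ring.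
  rewrite avgZ -mulrA ler_wpM2l// ler_wpM2l ?sqrtr_ge0// (avg_sqrt_le r0)// => r.
  exact: ltW.
have avgE : avg E = expected_sup n k alpha + alpha ^+ 2.
  by rewrite avgD (avg_cst r0) -expected_supE.
rewrite avgZ -expected_supE in sym; rewrite -/n -avgE.
have sk0 : 0 < Num.sqrt k%:R :> R by rewrite sqrtr_gt0.
rewrite -(ler_pM2l kR) (le_trans sym)//.
rewrite -[k%:R in X in _ <= X * _](sqr_sqrtr (ltW kR)).
apply: (@le_trans _ _ (2 * (B * (Num.sqrt k%:R * Num.sqrt (avg E))))).
  by rewrite ler_pM2l.
rewrite le_eqVlt; apply/orP; left; apply/eqP; field.
by rewrite gt_eqF.
Qed.

Lemma half_le_ln2 : 2^-1 <= ln 2 :> R.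
Proof.
rewrite -ler_expR lnK ?posrE//.
have := expR_ge1Dx (- 2^-1 : R); rewrite expRN => h.
have e0 := expR_gt0 (2^-1 : R).
by have := ler_wpM2l (ltW e0) h; rewrite mulfV ?gt_eqF//; lra.
Qed.

(** With x = ln n and y = ln k, both at least 1/2: D <= 66 y, and 2n + 1 <= n^3 gives ln(2n + 1) <=
    3 x. So [K] must exceed 198 x y + ln 2; 225 = 15^2 is a convenient square. Since m <= 2 x, the
    main term costs 24 * 15 * 2 = 720, and 4 is absorbed by 16 more. *)
Lemma entropy_le_rate m k : (0 < m)%N -> (2 <= k)%N ->
  exists (D : nat) (K : R), [/\ (0 < D)%N, 32 * ln (2 * k%:R) <= D%:R :> R,
    ln 2 + D%:R * ln (2 * (2 ^ m)%:R + 1) <= K &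
    m%:R * (24 * Num.sqrt K) + 4 <=
      736 * (ln (2 ^ m)%:R `^ (3 / 2) * Num.sqrt (ln k%:R))].
Proof.
move=> m0 k2; set x : R := ln (2 ^ m)%:R; set y : R := ln k%:R.
have kR : 0 < k%:R :> R by rewrite ltr0n (ltn_trans _ k2).
have nR : 0 < (2 ^ m)%:R :> R by rewrite ltr0n expn_gt0.
have n2 : 2 <= (2 ^ m)%:R :> R by rewrite ler_nat -[leqLHS]expn1 leq_exp2l.
have l2 := half_le_ln2.
have xm : x = m%:R * ln 2 by rewrite /x natrX lnXn// mulr_natl.
have ln2x : ln 2 <= x by rewrite ler_ln// posrE.
have ln2y : ln 2 <= y by rewrite ler_ln// ?posrE// ler_nat.
pose D := (Num.truncn (32 * ln (2 * k%:R) : R)).+1.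
have lnk : ln (2 * k%:R) <= 2 * y by rewrite lnM ?posrE//; rewrite -/y; lra.
have lnk0 : 0 <= ln (2 * k%:R) :> R by rewrite lnM ?posrE//; rewrite -/y; lra.
have D66 : D%:R <= 66 * y.
  have h : 0 <= 32 * ln (2 * k%:R) :> R by rewrite mulr_ge0.
  have -> : D%:R = (Num.truncn (32 * ln (2 * k%:R) : R))%:R + 1 :> R.
    by rewrite natr1.
  by move: h; rewrite -truncn_le; lra.
have lnn : ln (2 * (2 ^ m)%:R + 1) <= 3 * x.
  rewrite /x -[3 * _]/(3%:R * _) [leRHS]mulr_natl -lnXn// ler_ln ?posrE ?exprn_gt0//.
  have N4 : 2 * 2 <= (2 ^ m)%:R * (2 ^ m)%:R :> R by rewrite ler_pM.
  have := ler_wpM2r (ltW nR) N4; rewrite !exprS expr0 mulr1 => h.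
  by rewrite mulrA; lra.
have lnn0 : 0 <= ln (2 * (2 ^ m)%:R + 1) :> R.
  by rewrite ln_ge0// lerDr mulr_ge0// ltW.
have sx2 : Num.sqrt x ^+ 2 = x by rewrite sqr_sqrtr//; lra.
have sy2 : Num.sqrt y ^+ 2 = y by rewrite sqr_sqrtr//; lra.
have sx0 := sqrtr_ge0 x; have sy0 := sqrtr_ge0 y.
exists D, (225 * (x * y)); split=> //.
- exact/ltW/truncnS_gt.
- have : D%:R * ln (2 * (2 ^ m)%:R + 1) <= 66 * y * (3 * x) by rewrite ler_pM.
  have : 2^-1 * x <= y * x by rewrite ler_wpM2r; lra.
  by nra.
- have -> : x `^ (3 / 2) = x * Num.sqrt x.
    have x0 : 0 < x by lra.
    rewrite (_ : 3 / 2 = 1 + 2^-1); last by field.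
    rewrite powRD ?powRr1 ?powR12_sqrt ?ltW//.
    by rewrite (gt_eqF x0) implybT.
  have -> : Num.sqrt (225 * (x * y)) = 15 * (Num.sqrt x * Num.sqrt y).
    rewrite sqrtrM// (_ : 225 = 15 ^+ 2); last by rewrite -natrX.
    by rewrite sqrtr_sqr normr_nat sqrtrM//; lra.
  have mx : m%:R <= 2 * x by rewrite xm; have : 0 <= m%:R :> R by []; nra.
  set a := Num.sqrt x in sx2 sx0 *; set b := Num.sqrt y in sy2 sy0 *.
  have ab2 : 2^-1 <= a * b.
    have : 2^-1 ^+ 2 <= (a * b) ^+ 2 by rewrite exprMn sx2 sy2; nra.
    by rewrite ler_pXn2r// nnegrE ?mulr_ge0.
  have : m%:R * (a * b) <= 2 * x * (a * b) by rewrite ler_wpM2r// mulr_ge0.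
  have : 2^-1 * 2^-1 <= x * (a * b) by rewrite ler_pM//; lra.
  by lra.
Qed.

Lemma expected_sup_le_rate n k (alpha : R) :
  (exists m, n = (2 ^ m)%N) -> (2 <= k)%N -> 0 < alpha ->
  expected_sup n k alpha <=
    1472 * rate R n k * Num.sqrt (expected_sup n k alpha + alpha ^+ 2).
Proof.
move=> [m ->] k2 alpha0; have k0 : (0 < k)%N by exact: ltn_trans k2.
(* For n = 1 the rate is 0, so the expectation must vanish exactly; it does, all rows being
   equal. *)
have [->|m0] := posnP m.
  have r0 : {ffun 'I_k -> 'I_(2 ^ 0)} by exact: [ffun=> ord0].
  rewrite /rate ln1 powR0 ?mul0r ?mulr0 ?mul0r; last by rewrite mulf_neq0 ?invr_eq0 ?pnatr_eq0.
  rewrite expected_supE -[leRHS](avg_cst r0); apply: le_avg => r.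
  apply: sup_deviation_le => // x _; rewrite deviationE// big1 ?mulr0 ?normr0// => i _.
  have -> : avg (fun w => dot (hadamard R (2 ^ 0) w) x ^+ 2) =
      dot (hadamard R (2 ^ 0) (r i)) x ^+ 2.
    rewrite /avg card_ord invr1 mul1r big_ord1.
    by rewrite (ord1 (r i)).
  exact: subrr.
have [D [K [D0 Dk DK mK]]] := entropy_le_rate m0 k2.
apply: (le_trans (expected_sup_process k0 alpha0 D0 Dk DK)).
rewrite ler_wpM2r ?sqrtr_ge0// /rate [leRHS]mulrA ler_wpM2r ?invr_ge0 ?sqrtr_ge0//.
by move: mK; lra.
Qed.

Lemma rate_ge0 n k : 0 <= rate R n k.
Proof. by rewrite /rate !mulr_ge0 ?powR_ge0 ?invr_ge0 ?sqrtr_ge0. Qed.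

(** With s^2 = E + alpha^2, the hypothesis reads s^2 <= C q s + alpha^2, which forces s <= C q +
    alpha. Then E <= C q (C q + alpha), and one factor q is traded for c alpha. *)
Lemma self_bound (C c alpha q E : R) :
  0 < C -> 0 < c -> 0 < alpha -> 0 <= q -> q <= c * alpha -> 0 <= E ->
  E <= C * q * Num.sqrt (E + alpha ^+ 2) -> E <= (C ^+ 2 * c + C) * (alpha * q).
Proof.
move=> C0 c0 alpha0 q0 qc E0; set s := Num.sqrt _ => Es.
have s2 : s ^+ 2 = E + alpha ^+ 2 by rewrite sqr_sqrtr// addr_ge0// sqr_ge0.
have s0 : 0 <= s by exact: sqrtr_ge0.
have Cq0 : 0 <= C * q by rewrite mulr_ge0// ltW.
have sle : s <= C * q + alpha.
  rewrite leNgt; apply/negP => slt.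
  have : (C * q + alpha) * s < s * s by rewrite ltr_pM2r//; lra.
  have : alpha * alpha <= alpha * s by rewrite ler_pM2l//; lra.
  by rewrite mulrDl; lra.
have h1 : E <= C * q * (C * q + alpha) by rewrite (le_trans Es)// ler_wpM2l.
have h2 : C ^+ 2 * q * q <= C ^+ 2 * q * (c * alpha).
  by rewrite ler_wpM2l// mulr_ge0// sqr_ge0.
by lra.
Qed.

End ExpectedSup.

Theorem theorem1 (R : realType) :
  (exists C1 : R, 0 < C1 /\
     forall (n k : nat) (alpha : R),
       (exists m : nat, n = (2 ^ m)%N) -> (2 <= k)%N -> 0 < alpha ->
       expected_sup n k alpha <=
         C1 * rate R n k * Num.sqrt (expected_sup n k alpha + alpha ^+ 2))
  /\
  (forall c : R, 0 < c ->
     exists C2 : R, 0 < C2 /\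
       forall (n k : nat) (alpha : R),
         (exists m : nat, n = (2 ^ m)%N) -> (2 <= k)%N -> 0 < alpha ->
         rate R n k <= c * alpha ->
         expected_sup n k alpha <= C2 * (alpha * rate R n k)).
Proof.
have C0 : 0 < 1472 :> R by rewrite ltr0n.
move: (1472 : R) C0 (@expected_sup_le_rate R) => C C0 bound.
split; first by exists C.
move=> c c0; exists (C ^+ 2 * c + C); split.
  by rewrite addr_gt0// mulr_gt0// exprn_gt0.
move=> n k alpha n2 k2 alpha0 rc; apply: self_bound => //.
- exact: rate_ge0.
- rewrite expected_supE mulr_ge0 ?invr_ge0// sumr_ge0// => r _.
  exact: sup_deviation_ge0.
- exact: bound.
Qed.
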